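(* For every convergent $\mathbb{N}^*$-decorated rooted forest $F$, the convergent arborified zeta value $\zeta^{T}_{\mathrm{st}}(F)$ (resp. $\zeta^{T,\star}_{\mathrm{st}}(F)$) is a finite linear combination, with rational coefficients, of convergent multiple zeta values $\zeta_{\mathrm{st}}(w)$ (resp. $\zeta^{\star}_{\mathrm{st}}(w)$), $w$ convergent words in the alphabet $\mathbb{N}^*$. More precisely, it can be written as a finite linear combination of such values with integer coefficients.
   Context: $\mathbb{N}^*=\mathbb{Z}_{\ge 1}$. A rooted forest is a finite (possibly empty) disjoint union of finite (non-planar) rooted trees; an $\Omega$-decorated forest carries a map $d$ from its vertex set to $\Omega$; forests are taken up to isomorphism. $\mathcal{F}_\Omega$ is the commutative unital $\mathbb{R}$-algebra freely generated by nonempty $\Omega$-decorated rooted trees: its product is concatenation (disjoint union) of forests, its unit is the empty forest $\emptyset$, and forests form a linear basis. For $\omega\in\Omega$ and a forest $F$, $B_+^\omega(F)$ is the tree obtained from $F$ by adding a new root decorated by $\omega$ joined to every root of $F$ (extended linearly). An $\mathbb{N}^*$-decorated forest is convergent if it is empty or if all roots of its trees have decoration $\ge 2$. A word in the alphabet $\mathbb{N}^*$ is convergent if it is empty or its first (leftmost) letter is $\ge 2$. For $\lambda\in\{-1,0\}$, define for each forest a function $\mathcal{Z}_\lambda(F):\mathbb{N}^*\to\mathbb{R}$ by $\mathcal{Z}_\lambda(\emptyset)=1$, $\mathcal{Z}_\lambda(F_1F_2)=\mathcal{Z}_\lambda(F_1)\mathcal{Z}_\lambda(F_2)$ (pointwise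 product), and $\mathcal{Z}_\lambda(B_+^\alpha(F))(N)=\sum_{n=1}^{N+\lambda}n^{-\alpha}\,\mathcal{Z}_\lambda(F)(n)$ (an empty sum is $0$). For convergent $F$ the limits $\zeta^{T}_{\mathrm{st}}(F)=\lim_{N\to\infty}\mathcal{Z}_{-1}(F)(N)$ and $\zeta^{T,\star}_{\mathrm{st}}(F)=\lim_{N\to\infty}\mathcal{Z}_{0}(F)(N)$ exist and are finite. For a convergent word $w=(\omega_1\cdots\omega_k)$, $\zeta_{\mathrm{st}}(w)$ and $\zeta^\star_{\mathrm{st}}(w)$ are $\zeta^T_{\mathrm{st}}$ and $\zeta^{T,\star}_{\mathrm{st}}$ of the ladder tree $B_+^{\omega_1}\circ\cdots\circ B_+^{\omega_k}(\emptyset)$, i.e. $\zeta_{\mathrm{st}}(w)=\sum_{n_1>\cdots>n_k\ge1}\prod_i n_i^{-\omega_i}$ and $\zeta^\star_{\mathrm{st}}(w)=\sum_{n_1\ge\cdots\ge n_k\ge1}\prod_i n_i^{-\omega_i}$, with value $1$ on the empty word. *)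

(* Defs.v *)
From HB Require Import structures.
From mathcomp Require Import all_boot all_order all_algebra.
From mathcomp Require Import all_classical all_reals all_analysis.
From mathcomp Require Import ring lra.
Import Order.TTheory GRing.Theory Num.Theory.
Import numFieldNormedType.Exports.

Set Implicit Arguments.
Unset Strict Implicit.
Unset Printing Implicit Defensive.

Local Open Scope classical_set_scope.
Local Open Scope ring_scope.

Definition nstar := {n : nat | (0 < n)%N}.

(* Planar representatives of non-planar decorated rooted trees: the order of
   the list of children is irrelevant. Isomorphism of non-planar forests is
   [forest_iso]; every notion below is invariant under it ([convergent_iso],
   [arbZ_iso]). *)
Inductive rtree (Omega : Type) : Type := Bplus of Omega & seq (rtree Omega).

Definition forest (Omega : Type) := seq (rtree Omega).

Definition root_dec (Omega : Type) (t : rtree Omega) : Omega :=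
  let: Bplus a _ := t in a.

Inductive forest_iso (Omega : Type) : forest Omega -> forest Omega -> Prop :=
| Iso_nil : forest_iso [::] [::]
| Iso_cons a F F' G G' : forest_iso F F' -> forest_iso G G' ->
    forest_iso (Bplus a F :: G) (Bplus a F' :: G')
| Iso_swap t u F : forest_iso [:: t, u & F] [:: u, t & F]
| Iso_trans F G H : forest_iso F G -> forest_iso G H -> forest_iso F H.

Definition convergent_forest (F : forest nstar) : bool :=
  all (fun t => (2 <= val (root_dec t))%N) F.

Definition convergent_word (w : seq nstar) : bool :=
  if w is a :: _ then (2 <= val a)%N else true.

Section ArborifiedZeta.
Variable R : realType.
Implicit Type star : bool.

(* The boolean [star] stands for the parameter lambda in {-1, 0}, through
   lambda = star - 1: the sum over 1 <= n <= N + lambda is the sum over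
   1 <= n < N + star. *)
Fixpoint arbZ_tree star (t : rtree nstar) : R ^nat :=
  let: Bplus a F := t in
  fun N => \sum_(1 <= n < N + star)
    n%:R ^- val a * \prod_(z <- map (fun u => arbZ_tree star u n) F) z.

Definition arbZ star (F : forest nstar) : R ^nat :=
  fun N => \prod_(t <- F) arbZ_tree star t N.

(* These limits exist for convergent forests: see [is_cvg_arbZ]. *)
Definition zetaT (F : forest nstar) : R := limn (arbZ false F).
Definition zetaTstar (F : forest nstar) : R := limn (arbZ true F).

End ArborifiedZeta.

Definition ladder (Omega : Type) (w : seq Omega) : forest Omega :=
  foldr (fun a F => [:: Bplus a F]) [::] w.

Definition zeta_word (R : realType) (w : seq nstar) : R :=
  zetaT R (ladder w).
Definition zetastar_word (R : realType) (w : seq nstar) : R :=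
  zetaTstar R (ladder w).

(* [x] is a finite linear combination of the values [z w], for [w] convergent
   words, with coefficients in the image of [inj : K -> R]. *)
Definition is_conv_word_comb (R : realType) (K : Type) (inj : K -> R)
    (z : seq nstar -> R) (x : R) : Prop :=
  exists s : seq (K * seq nstar),
    all (fun p => convergent_word p.2) s /\
    x = \sum_(p <- s) inj p.1 * z p.2.

Section WellDefined.

Lemma forest_ind (Omega : Type) (P : forest Omega -> Prop) :
  P [::] -> (forall a F G, P F -> P G -> P (Bplus a F :: G)) ->
  forall F, P F.
Proof.
move=> P0 PS.
have Pt : forall t G, P G -> P (t :: G).
  fix IH 1 => -[a F] G PG; apply: PS => //.
  by elim: F => [|u F IHF] //; apply: IH.
by elim=> [|t F IHF] //; apply: Pt.
Qed.

Lemma convergent_iso (F G : forest nstar) :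
  forest_iso F G -> convergent_forest F = convergent_forest G.
Proof.
elim=> {F G} [|a F F' G G' _ _ _ /= ->|t u F|F G H _ -> _ ->] //=.
by rewrite andbCA.
Qed.

Variable R : realType.
Implicit Types (star : bool) (F G : forest nstar).

Lemma arbZ0 star N : arbZ R star [::] N = 1.
Proof. by rewrite /arbZ big_nil. Qed.

Lemma arbZ_cat star F G N :
  arbZ R star (F ++ G) N = arbZ R star F N * arbZ R star G N.
Proof. by rewrite /arbZ big_cat. Qed.

Lemma arbZ_Bplus star a F N :
  arbZ R star [:: Bplus a F] N =
  \sum_(1 <= n < N + star) n%:R ^- val a * arbZ R star F n.
Proof. by rewrite /arbZ big_seq1 /=; under eq_bigr do rewrite big_map. Qed.

Lemma arbZ_cons star t F N :
  arbZ R star (t :: F) N = arbZ R star [:: t] N * arbZ R star F N.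
Proof. exact: (arbZ_cat star [:: t]). Qed.

Lemma arbZ_iso star F G :
  forest_iso F G -> arbZ R star F = arbZ R star G.
Proof.
elim=> {F G} [|a F F' G G' _ IHF _ IHG|t u F|F G H _ -> _ ->] //;
  apply/funext => N.
- by rewrite arbZ_cons [RHS]arbZ_cons !arbZ_Bplus IHF IHG.
- by rewrite /arbZ !big_cons mulrCA.
Qed.

Lemma arbZ_ge0 star F N : 0 <= arbZ R star F N.
Proof.
elim/forest_ind: F N => [|a F G IHF IHG] N; first by rewrite arbZ0.
rewrite arbZ_cons mulr_ge0// arbZ_Bplus sumr_ge0// => n _.
by rewrite mulr_ge0// invr_ge0 exprn_ge0.
Qed.

Let Hn (n : nat) : R := \sum_(1 <= m < n.+1) m%:R^-1.

Let HnS n : Hn n.+1 = Hn n + n.+1%:R^-1.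
Proof. by rewrite /Hn big_nat_recr. Qed.

Let Hn_ge0 n : 0 <= Hn n.
Proof. by rewrite sumr_ge0. Qed.

Let le_Hn : {homo Hn : m n / (m <= n)%N >-> m <= n}.
Proof.
apply: homo_leq => // [x y z|n]; first exact: le_trans.
by rewrite HnS lerDl.
Qed.

Let Hn_le_ln n : Hn n.+1 <= 1 + ln n.+1%:R.
Proof.
elim: n => [|n IHn]; first by rewrite /Hn big_nat1 invr1 ln1 addr0.
rewrite HnS; set x := n.+2%:R^-1.
have n1_gt0 : 0 < n.+1%:R :> R by rewrite ltr0n.
have n2_gt0 : 0 < n.+2%:R :> R by rewrite ltr0n.
suff : ln (n.+1%:R : R) <= ln n.+2%:R - x by move: IHn; lra.
rewrite -(expRK (- x)) -lnM ?posrE ?expR_gt0//.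
rewrite ler_ln ?posrE ?mulr_gt0 ?expR_gt0//.
apply: le_trans (_ : n.+2%:R * (1 - x) <= _); last first.
  by rewrite ler_pM2l// expR_ge1Dx.
by rewrite mulrBr mulr1 divff ?gt_eqF// -[in X in _ <= X]natr1 addrK.
Qed.

Let Hn_growth k : exists2 C : R, 0 <= C &
  forall n, Hn n.+1 ^+ k <= C * Num.sqrt n.+1%:R.
Proof.
case: k => [|k].
  exists 1 => // n; rewrite expr0 mul1r -{1}sqrtr1 ler_wsqrtr// ler1n.
  by [].
pose d : R := (2 * k.+1)%:R.
have d_gt0 : 0 < d by rewrite ltr0n.
exists (d ^+ k.+1 * expR 2^-1) => [|n].
  by rewrite mulr_ge0 ?exprn_ge0 ?expR_ge0// ltW.
have ln_ge : 0 <= ln (n.+1%:R : R) by rewrite ln_ge0// ler1n.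
have n1_gt0 : 0 < n.+1%:R :> R by rewrite ltr0n.
apply: le_trans (_ : (1 + ln n.+1%:R) ^+ k.+1 <= _).
  by rewrite lerXn2r ?nnegrE ?Hn_ge0 ?Hn_le_ln// addr_ge0.
set y : R := (1 + ln n.+1%:R) / d.
have y_ge0 : 0 <= y by rewrite divr_ge0 ?addr_ge0// ltW.
have -> : 1 + ln n.+1%:R = d * y by rewrite mulrC divfK// gt_eqF.
rewrite exprMn -mulrA ler_pM2l ?exprn_gt0//.
apply: le_trans (_ : expR y ^+ k.+1 <= _).
  rewrite lerXn2r ?nnegrE ?expR_ge0//.
  by apply: le_trans (expR_ge1Dx y); rewrite lerDr.
suff -> : expR y ^+ k.+1 = expR 2^-1 * Num.sqrt n.+1%:R by [].
rewrite -expRM_natl.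
have -> : k.+1%:R * y = 2^-1 + ln n.+1%:R / 2.
  have k1 : k.+1%:R != 0 :> R by rewrite pnatr_eq0.
  by rewrite /y /d natrM; field.
rewrite expRD; congr (_ * _).
apply/eqP; rewrite -(@eqrXn2 _ 2)// ?expR_ge0// sqr_sqrtr ?ltW//.
by rewrite -expRM_natl mulrCA divff ?pnatr_eq0// mulr1 lnK.
Qed.

Let arbZ_le_Hn star F :
  exists k, forall n, (0 < n)%N -> arbZ R star F n <= Hn n ^+ k.
Proof.
elim/forest_ind: F => [|a F G [k IHF] [l IHG]].
  by exists 0 => n _; rewrite arbZ0 expr0.
exists (k.+1 + l)%N => n n_gt0.
rewrite arbZ_cons exprD ler_pM ?arbZ_ge0 ?IHG//.
rewrite arbZ_Bplus exprS /Hn mulr_suml -/(Hn n).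
apply: le_trans (_ : \sum_(1 <= i < n + star) i%:R^-1 * Hn n ^+ k <= _).
  apply: ler_sum_nat => i /andP[i_gt0 i_lt].
  have i_le : (i <= n)%N.
    by rewrite -ltnS; apply: leq_trans i_lt _; case: (star); rewrite ?addn1 ?addn0.
  apply: ler_pM; rewrite ?arbZ_ge0 ?invr_ge0 ?exprn_ge0//.
    rewrite lef_pV2 ?posrE ?exprn_gt0 ?ltr0n//.
    by rewrite -[leLHS]expr1; apply: ler_weXn2l; rewrite ?ler1n//; case: (a).
  apply: le_trans (IHF _ i_gt0) _.
  by rewrite lerXn2r ?nnegrE ?Hn_ge0 ?le_Hn.
case: (star) => /=; first by rewrite addn1.
rewrite addn0 [leRHS]big_nat_recr//= lerDl mulr_ge0 ?invr_ge0 ?exprn_ge0//.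
Qed.

Let sum_sqrt n :
  \sum_(1 <= i < n.+2) i%:R ^- 2 * Num.sqrt (i%:R : R) <=
  3 - 2 / Num.sqrt n.+1%:R.
Proof.
elim: n => [|n IHn]; first by rewrite big_nat1 sqrtr1 expr1n invr1; lra.
rewrite big_nat_recr//=.
set r : R := Num.sqrt n.+1%:R in IHn *; set s : R := Num.sqrt n.+2%:R.
have r_gt0 : 0 < r by rewrite sqrtr_gt0.
have s_gt0 : 0 < s by rewrite sqrtr_gt0.
have rs : r <= s by rewrite ler_wsqrtr// ler_nat.
have r2 : r ^+ 2 = n.+1%:R by rewrite sqr_sqrtr.
have s2 : s ^+ 2 = n.+2%:R by rewrite sqr_sqrtr.
have s2r : s ^+ 2 = r ^+ 2 + 1 by rewrite s2 r2 natr1.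
rewrite -s2; apply: le_trans (lerD IHn (lexx _)) _.
suff : (s ^+ 2) ^- 2 * s <= 2 / r - 2 / s by lra.
have -> : (s ^+ 2) ^- 2 * s = (s ^+ 3)^-1.
  by field; rewrite gt_eqF.
have -> : 2 / r - 2 / s = 2 / (r * s * (s + r)).
  have : (s - r) * (s + r) = 1 by rewrite -subr_sqr s2r addrC addKr.
  have ? : r != 0 by rewrite gt_eqF.
  have ? : s != 0 by rewrite gt_eqF.
  have sr : s + r != 0 by rewrite gt_eqF// addr_gt0.
  move=> E; rewrite -[in RHS](mulr1 2) -E; field.
  by apply/and3P.
have p_gt0 : 0 < r * s * (s + r) by rewrite !mulr_gt0 ?addr_gt0.
rewrite ler_pdivlMr// mulrC ler_pdivrMr ?exprn_gt0//.
rewrite exprS expr2.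
by rewrite [leLHS]mulrC; nra.
Qed.

Lemma is_cvg_arbZ star F : convergent_forest F -> cvgn (arbZ R star F).
Proof.
elim: F => [_|[a F] G IHG /= /andP[a_ge2 /IHG {}IHG]].
  have -> : arbZ R star [::] = fun=> 1 by apply/funext => N; rewrite arbZ0.
  exact: is_cvg_cst.
have -> : arbZ R star (Bplus a F :: G) =
    arbZ R star [:: Bplus a F] \* arbZ R star G.
  by apply/funext => N; rewrite arbZ_cons.
apply: is_cvgM IHG.
have term_ge0 n : 0 <= n%:R ^- val a * arbZ R star F n.
  by rewrite mulr_ge0 ?arbZ_ge0 ?invr_ge0 ?exprn_ge0.
have sum_le : {homo (fun N => \sum_(1 <= n < N) n%:R ^- val a * arbZ R star F n)
    : m n / (m <= n)%N >-> m <= n}.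
  apply: homo_leq => // [x y z|[|n]]; first exact: le_trans.
    by rewrite !big_geq.
  by rewrite [leRHS]big_nat_recr//= lerDl.
apply: nondecreasing_is_cvgn => [m n mn|].
  by rewrite !arbZ_Bplus; apply: sum_le; rewrite leq_add2r.
have [k Hk] := arbZ_le_Hn star F.
have [C C_ge0 HC] := Hn_growth k.
exists (C * 3) => _ [N _ <-].
rewrite arbZ_Bplus; apply: le_trans (sum_le _ N.+2 _) _.
  by case: (star) => /=; rewrite ?addn1 ?addn0 ltnW.
apply: le_trans (_ : C * \sum_(1 <= i < N.+2) i%:R ^- 2 * Num.sqrt i%:R <= _).
  rewrite mulr_sumr; apply: ler_sum_nat => -[//|i] _.
  rewrite mulrCA ler_pM ?arbZ_ge0 ?invr_ge0 ?exprn_ge0//.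
    by rewrite lef_pV2 ?posrE ?exprn_gt0 ?ltr0n// ler_weXn2l// ler1n.
  by apply: le_trans (Hk _ _) _.
rewrite ler_wpM2l//; apply: le_trans (sum_sqrt N) _.
by rewrite gerBl divr_ge0 ?sqrtr_ge0.
Qed.

End WellDefined.

(* Main.v *)
Require Import Defs.
From mathcomp Require Import all_boot all_order all_algebra.
From mathcomp Require Import all_classical all_reals all_analysis.
From mathcomp Require Import ring.
Import GRing.Theory.
Import numFieldNormedType.Exports.
Local Open Scope ring_scope.

(** The theorem is the limit of an identity between truncated sums: for every
    forest [F], the function [arbZ R star F] is an integer combination of the
    functions [arbZ R star (ladder w)], for finitely many words [w], which can
    be taken convergent when [F] is ([word_comb_arbZ]). This flattening of [F]
    into words goes by induction on [F]. Grafting onto a root decorated by [a]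
    is the linear operator [psum star a], which on ladders prefixes the letter
    [a]. Concatenation of forests is the pointwise product, so what is needed is
    that a product of two ladders is a combination of ladders. This is the
    quasi-shuffle product: in a product of two nested sums the outermost
    indices [n] and [m] satisfy [n > m], [n < m] or [n = m], and on the diagonal
    the letters [a] and [b] merge into [a + b] ([psumM]). For large
    inequalities (the star case) the first two regions overlap on the diagonal,
    which is then subtracted instead of added; hence the coefficients stay
    integral in both cases.

    Convergence is preserved because the first letter of each word arising
    from nonempty convergent words led by [a] and [b] is [a], [b] or [a + b],
    all at least 2. Thus only convergent sequences are combined, finitely many
    of them, and the identity passes to the limit. *)

Section Flattening.
Variable R : realType.
Implicit Types (star c : bool) (a b : nstar) (f g : R ^nat).
Implicit Types (u v w : seq nstar) (F G : forest nstar).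

Definition psum star a f : R ^nat :=
  fun N => \sum_(1 <= n < N + star) n%:R ^- val a * f n.

Lemma arbZ_graft star a F :
  arbZ R star [:: Bplus a F] = psum star a (arbZ R star F).
Proof. by apply/funext => N; rewrite arbZ_Bplus. Qed.

Lemma nstar_add_gt0 a b : (0 < val a + val b)%N.
Proof. by rewrite addn_gt0 (valP a). Qed.

Definition nstar_add a b : nstar :=
  exist (fun n => is_true (0 < n)%N) _ (nstar_add_gt0 a b).

Lemma nstar_add_ge2 a b : (2 <= val (nstar_add a b))%N.
Proof. exact: leq_add (valP a) (valP b). Qed.

Lemma psumS star a f N :
  psum star a f N.+1 = psum star a f N +
    (if (0 < N + star)%N then (N + star)%:R ^- val a * f (N + star)%N else 0).
Proof.
rewrite /psum addSn; case: posnP => [->|N_gt0].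
  by rewrite !big_geq// addr0.
by rewrite big_nat_recr.
Qed.

(** A Leibniz rule with defect, of Rota-Baxter type: the sign of the diagonal
    term is +1 for strict inequalities, where the diagonal is missing from the
    first two terms, and -1 for large ones, where it is counted twice. *)
Lemma psumM star a b f g N :
  psum star a f N * psum star b g N =
  psum star a (f \* psum star b g) N + psum star b (psum star a f \* g) N
    + (-1) ^+ star * psum star (nstar_add a b) (f \* g) N.
Proof.
elim: N => [|N IHN].
  have psum0 d h : psum star d h 0 = 0 by rewrite /psum big_geq//; case: star.
  by rewrite !psum0 !mulr0 !addr0.
have split_pow (n : nat) : n%:R ^- val (nstar_add a b) =
    n%:R ^- val a * n%:R ^- val b :> R by rewrite exprD invfM.
rewrite !psumS; case: ifP => [_|_]; last by rewrite !addr0.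
rewrite split_pow mulrDl !mulrDr IHN.
(* In the star case the inner sums run up to the new index itself. *)
case: star {IHN} => /=; rewrite ?addn1 ?addn0 ?psumS ?addn1/=; ring.
Qed.

(** Convergence of the words is requested only when the flag [c] is set, because
    it is not hereditary: the letters after the first one of a convergent word,
    and the decorations below the roots of a convergent forest, are arbitrary,
    so the inductions go through the unconstrained case. *)
Definition word_comb star c f : Prop :=
  exists s : seq (int * seq nstar),
    all (fun p => c ==> convergent_word p.2) s /\
    forall N, f N = \sum_(p <- s) p.1%:~R * arbZ R star (ladder p.2) N.

Lemma word_comb_ext star c f g : f =1 g ->
  word_comb star c f -> word_comb star c g.
Proof. by move=> fg [s [hs hf]]; exists s; split=> // N; rewrite -fg hf. Qed.

Lemma word_comb_weaken star c c' f : (c' ==> c) ->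
  word_comb star c f -> word_comb star c' f.
Proof.
case: c' => [/= ->//|_ [s [_ hf]]]; exists s; split=> //.
by apply/allP.
Qed.

Lemma word_comb0 star c : word_comb star c (fun=> 0).
Proof. by exists [::]; split=> // N; rewrite big_nil. Qed.

Lemma word_combD star c f g : word_comb star c f -> word_comb star c g ->
  word_comb star c (fun N => f N + g N).
Proof.
move=> [s [hs hf]] [t [ht hg]]; exists (s ++ t).
by rewrite all_cat hs ht; split=> // N; rewrite big_cat/= hf hg.
Qed.

Lemma word_combZ star c (k : int) f : word_comb star c f ->
  word_comb star c (fun N => k%:~R * f N).
Proof.
move=> [s [hs hf]]; exists [seq (k * p.1, p.2) | p <- s]; split.
  by rewrite all_map.
move=> N; rewrite hf mulr_sumr big_map; apply: eq_bigr => p _ /=.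
by rewrite intrM mulrA.
Qed.

Lemma word_comb_sum star c (s : seq (int * seq nstar))
    (f : seq nstar -> R ^nat) :
  (forall p, p \in s -> word_comb star c (f p.2)) ->
  word_comb star c (fun N => \sum_(p <- s) p.1%:~R * f p.2 N).
Proof.
elim: s => [_|p s IHs hs].
  by apply: word_comb_ext (word_comb0 star c) => N; rewrite big_nil.
apply: (@word_comb_ext _ _
    (fun N => p.1%:~R * f p.2 N + \sum_(q <- s) q.1%:~R * f q.2 N)).
  by move=> N; rewrite big_cons.
apply: word_combD; first by apply: word_combZ; apply: hs; exact: mem_head.
by apply: IHs => q qs; apply: hs; rewrite in_cons qs orbT.
Qed.

Lemma word_comb_ladder star c w : (c ==> convergent_word w) ->
  word_comb star c (arbZ R star (ladder w)).
Proof.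
move=> hw; exists [:: (1, w)]; rewrite /= hw; split=> // N.
by rewrite big_seq1 mul1r.
Qed.

Lemma word_comb_psum star c a f : (c ==> (2 <= val a)%N) ->
  word_comb star false f -> word_comb star c (psum star a f).
Proof.
move=> ha [s [_ hf]].
apply: (@word_comb_ext _ _ (fun N =>
    \sum_(p <- s) p.1%:~R * arbZ R star (ladder (a :: p.2)) N)).
  move=> N; under eq_bigr => p _ do rewrite arbZ_graft mulr_sumr.
  rewrite exchange_big; apply: eq_bigr => n _ /=.
  by rewrite hf mulr_sumr; apply: eq_bigr => p _; rewrite mulrCA.
apply: (word_comb_sum _ _ _ (fun w => arbZ R star (ladder (a :: w)))) => p _.
exact: word_comb_ladder.
Qed.

(** The quasi-shuffle of two words, by recursion through [psumM]: each of its
    three terms is a nested sum over a product of two shorter words. *)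
Lemma word_comb_ladderM star v w :
  word_comb star (convergent_word v && convergent_word w)
    (arbZ R star (ladder v) \* arbZ R star (ladder w)).
Proof.
elim: v w => [|a v IHv] w.
  apply: word_comb_ext (word_comb_ladder star _ w (implybb _)) => N /=.
  by rewrite arbZ0 mul1r.
elim: w => [|b w IHw].
  apply: word_comb_ext (word_comb_ladder star _ (a :: v) _) => [N|].
    by rewrite /= arbZ0 mulr1.
  by rewrite andbT implybb.
have unconstrained c f : word_comb star c f -> word_comb star false f.
  exact: word_comb_weaken.
apply: word_comb_ext (fun N => esym _) _.
  by move=> N; rewrite /= !arbZ_graft psumM.
rewrite -!arbZ_graft; apply: word_combD; first apply: word_combD.
- apply: word_comb_psum (unconstrained _ _ (IHv (b :: w))).
  by apply/implyP => /andP[].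
- apply: word_comb_psum (unconstrained _ _ IHw).
  by apply/implyP => /andP[].
- apply: (@word_comb_ext _ _ (fun N => ((-1) ^+ star)%:~R * psum star
      (nstar_add a b) (arbZ R star (ladder v) \* arbZ R star (ladder w)) N)).
    by move=> N; rewrite rmorphXn rmorphN1.
  apply: word_combZ; apply: word_comb_psum (unconstrained _ _ (IHv w)).
  by apply/implyP => _; exact: nstar_add_ge2.
Qed.

Lemma word_combM star c f g : word_comb star c f -> word_comb star c g ->
  word_comb star c (f \* g).
Proof.
move=> [s [/allP hs hf]] [t [/allP ht hg]].
apply: (@word_comb_ext _ _ (fun N => \sum_(p <- s) p.1%:~R *
    \sum_(q <- t) q.1%:~R *
      (arbZ R star (ladder p.2) \* arbZ R star (ladder q.2)) N)).
  move=> N /=; rewrite hf hg mulr_suml; apply: eq_bigr => p _.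
  rewrite -mulrA; congr (_ * _); rewrite mulr_sumr; apply: eq_bigr => q _.
  by rewrite mulrCA.
apply: (word_comb_sum _ _ _ (fun v N => \sum_(q <- t) q.1%:~R *
    (arbZ R star (ladder v) \* arbZ R star (ladder q.2)) N)) => p /hs hp.
apply: (word_comb_sum _ _ _ (fun w =>
    arbZ R star (ladder p.2) \* arbZ R star (ladder w))) => q /ht hq.
apply: word_comb_weaken (word_comb_ladderM star p.2 q.2).
by apply/implyP => cT; rewrite (implyP hp) // (implyP hq).
Qed.

Lemma word_comb_arbZ star F :
  word_comb star (convergent_forest F) (arbZ R star F).
Proof.
elim/forest_ind: F => [|a F G IHF IHG].
  exact: (word_comb_ladder star _ [::]).
apply: (@word_comb_ext _ _ (arbZ R star [:: Bplus a F] \* arbZ R star G)).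
  by move=> N; rewrite [RHS]arbZ_cons.
apply: word_combM.
  rewrite arbZ_graft; apply: word_comb_psum; first by apply/implyP => /andP[].
  exact: word_comb_weaken IHF.
by apply: word_comb_weaken IHG; apply/implyP => /andP[].
Qed.

Lemma convergent_ladder w : convergent_forest (ladder w) = convergent_word w.
Proof. by case: w => //= a w; rewrite andbT. Qed.

(** Linearity of the limit needs each term to converge, which holds because the
    flag is set. *)
Lemma lim_word_comb star f : word_comb star true f ->
  is_conv_word_comb (fun k : int => k%:~R : R)
    (fun w => limn (arbZ R star (ladder w))) (limn f).
Proof.
move=> [s [hs hf]]; exists s; split=> //.
have -> : f = fun N => \sum_(p <- s) p.1%:~R * arbZ R star (ladder p.2) N.
  exact/funext.
apply/cvg_lim => //; rewrite big_seq.
under eq_fun do rewrite big_seq.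
apply: cvg_big => [|p /(allP hs) /= hp]; first exact: add_continuous.
by apply: cvgMl_tmp; apply: is_cvg_arbZ; rewrite convergent_ladder.
Qed.

Lemma int_rat_word_comb (z : seq nstar -> R) (x : R) :
  is_conv_word_comb (fun k : int => k%:~R : R) z x ->
  is_conv_word_comb (fun q : rat => ratr q : R) z x.
Proof.
move=> [s [hs ->]]; exists [seq (p.1%:~R, p.2) | p <- s]; rewrite all_map.
by split=> //; rewrite big_map; apply: eq_bigr => p _; rewrite /= ratr_int.
Qed.

End Flattening.

Theorem theorem1 (R : realType) (F : forest nstar)
    (hF : convergent_forest F) :
  (is_conv_word_comb (fun q : rat => ratr q : R) (zeta_word R) (zetaT R F) /\
   is_conv_word_comb (fun q : rat => ratr q : R)
     (zetastar_word R) (zetaTstar R F)) /\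
  (is_conv_word_comb (fun k : int => k%:~R : R) (zeta_word R) (zetaT R F) /\
   is_conv_word_comb (fun k : int => k%:~R : R)
     (zetastar_word R) (zetaTstar R F)).
Proof.
have int_comb star : is_conv_word_comb (fun k : int => k%:~R : R)
    (fun w => limn (arbZ R star (ladder w))) (limn (arbZ R star F)).
  by apply: lim_word_comb; rewrite -hF; exact: word_comb_arbZ.
have [strict large] := (int_comb false, int_comb true).
by split; split=> //; apply: int_rat_word_comb.
Qed.
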